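(* Let $\mathbf{x}\in\mathbb{R}_+^N$ be an aggregate demand bundle. Define the earliest-deadline-first (EDF) policy $\sigma^*=(\boldsymbol{\mu}_0^*,\dots,\boldsymbol{\mu}_{N-1}^*,\boldsymbol{\nu}_0^*,\dots,\boldsymbol{\nu}_{N-1}^* )$ componentwise (recursively in $j$) by $$\mu_k^{j,*}(\mathbf{z},s)=\min\Big\{z^j,\ s-\sum_{i=1}^{j-1}\mu_k^{i,*}(\mathbf{z},s)\Big\},\qquad \nu_k^{j,*}(\mathbf{z},s)=\big(z^j-\mu_k^{j,*}(\mathbf{z},s)\big)\cdot\mathbf{1}_{\{k=j-1\}},$$ for $j=1,\dots,N$, $k=0,\dots,N-1$ and $(\mathbf{z},s)\in\mathcal{Z}_k\times\mathcal{S}$. Then $\sigma^*\in\Sigma(\mathbf{x})$ and $\sigma^*$ is optimal, i.e. $Q(\mathbf{x},\sigma^* )\le Q(\mathbf{x},\sigma)$ for all $\sigma\in\Sigma(\mathbf{x})$.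
   Context: Fix $N\ge 1$ and a price $c_0>0$ of firm supply. Time periods are $k=0,\dots,N-1$. The intermittent supply is a random process $\mathbf{s}=(s_0,\dots,s_{N-1})$ with given joint distribution, where each $s_k$ takes values in an interval $\mathcal{S}\subset\mathbb{R}_+$; it has zero marginal cost. An aggregate demand bundle is $\mathbf{x}=(x_1,\dots,x_N)\in\mathbb{R}_+^N$, where $x_j$ is the energy to be delivered to demand class $j$ by deadline $j$ (i.e. during periods $0,\dots,j-1$). State dynamics: $\mathbf{z}_0=\mathbf{x}$ and $\mathbf{z}_{k+1}=\mathbf{z}_k-\mathbf{u}_k-\mathbf{v}_k$, where $\mathbf{u}_k,\mathbf{v}_k\in\mathbb{R}_+^N$ are the amounts of intermittent and firm supply allocated to each class in period $k$. The feasible state sets are $\mathcal{Z}_k=\{\mathbf{z}\in\mathbb{R}_+^N : z^j=0\ \forall j\le k\}$ (so $\mathcal{Z}_0=\mathbb{R}_+^N$). The feasible input sets are $$\mathcal{U}_k(\mathbf{z},s)=\{(\mathbf{u},\mathbf{v})\in\mathbb{R}_+^N\times\mathbb{R}_+^N : \mathbf{1}^\top\mathbf{u}\le s,\ \mathbf{z}-\mathbf{u}-\mathbf{v}\in\mathcal{Z}_{k+1}\}.$$ A feasible inter-class scheduling policy is a sequence $\sigma=(\boldsymbol{\mu}_0,\dots,\boldsymbol{\mu}_{N-1},\boldsymbol{\nu}_0,\dots,\boldsymbol{\nu}_{N-1})$ of (measurable) functions $\boldsymbol{\mu}_k,\boldsymbol{\nu}_k:\mathcal{Z}_k\times\mathcal{S}\to\mathbb{R}_+^N$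 with $(\boldsymbol{\mu}_k(\mathbf{z},s),\boldsymbol{\nu}_k(\mathbf{z},s))\in\mathcal{U}_k(\mathbf{z},s)$ for all $(\mathbf{z},s)\in\mathcal{Z}_k\times\mathcal{S}$ and all $k$; controls are $\mathbf{u}_k=\boldsymbol{\mu}_k(\mathbf{z}_k,s_k)$, $\mathbf{v}_k=\boldsymbol{\nu}_k(\mathbf{z}_k,s_k)$. $\Sigma(\mathbf{x})$ denotes the set of all such policies when the initial state is $\mathbf{z}_0=\mathbf{x}$. Writing $\mathbf{v}_k^\sigma$ for the resulting firm supply allocations, the expected cost of firm supply is $$Q(\mathbf{x},\sigma)=\sum_{k=0}^{N-1}\mathbb{E}\{\mathbf{c}^\top\mathbf{v}_k^\sigma\},\qquad \mathbf{c}=(c_0,\dots,c_0).$$ Superscript $j$ denotes the $j$-th component. *)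

(* Defs.v *)
From HB Require Import structures.
From mathcomp Require Import all_boot all_order all_algebra.
From mathcomp Require Import all_classical all_reals all_analysis.

Set Implicit Arguments.
Unset Strict Implicit.
Unset Printing Implicit Defensive.

Import Order.TTheory GRing.Theory Num.Theory.
Local Open Scope classical_set_scope.
Local Open Scope ring_scope.

(* Vectors of R^N are [N.-tuple R], which carries the product Borel
   sigma-algebra.  The component of index [j : 'I_N] is that of demand class
   j + 1, whose deadline is j + 1. *)

Section vectors.
Context {R : realType} {N : nat}.
Implicit Types u v : N.-tuple R.

Definition nonneg u : Prop := forall j, 0 <= tnth u j.

Definition vsub u v : N.-tuple R := [tuple tnth u j - tnth v j | j < N].

Definition dot u v : R := \sum_(j < N) tnth u j * tnth v j.

End vectors.

Section scheduling.
Context {R : realType} {N : nat}.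
Implicit Types (x z u v : N.-tuple R) (S : set R).

(* z^(j+1) = 0 whenever j + 1 <= k. *)
Definition feasible_state (k : nat) : set (N.-tuple R) :=
  [set z | nonneg z /\ forall j : 'I_N, (j.+1 <= k)%N -> tnth z j = 0].

Definition feasible_input (k : nat) z (s : R) :
    set (N.-tuple R * N.-tuple R) :=
  [set uv | [/\ nonneg uv.1, nonneg uv.2,
                \sum_(j < N) tnth uv.1 j <= s &
                feasible_state k.+1 (vsub (vsub z uv.1) uv.2)]].

(* The maps are total; only their values on feasible_state k x S matter. *)
Record policy := Policy {
  intermittent_policy : 'I_N -> N.-tuple R -> R -> N.-tuple R;
  firm_policy : 'I_N -> N.-tuple R -> R -> N.-tuple R }.
Implicit Types sigma : policy.

(* Feasibility is required at every state of feasible_state k, not only at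
   those reached from x; hence the set does not actually vary with the initial
   state x, which is kept as an argument only to match the notation
   Sigma(x). *)
Definition feasible_policies S x : set policy :=
  [set sigma | forall k : 'I_N,
    [/\ measurable_fun (feasible_state k `*` S)
          (fun p : N.-tuple R * R => intermittent_policy sigma k p.1 p.2),
        measurable_fun (feasible_state k `*` S)
          (fun p : N.-tuple R * R => firm_policy sigma k p.1 p.2) &
        forall z s, feasible_state k z -> S s ->
          feasible_input k z s
            (intermittent_policy sigma k z s, firm_policy sigma k z s)]].

(* The state z_k along a supply path [s], for k <= N; it is frozen after
   the last period. *)
Fixpoint state sigma x (s : 'I_N -> R) (k : nat) : N.-tuple R :=
  if k is k'.+1 then
    let z := state sigma x s k' in
    if insub k' is Some i then
      vsub (vsub z (intermittent_policy sigma i z (s i)))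
           (firm_policy sigma i z (s i))
    else z
  else x.

Lemma stateS sigma x (s : 'I_N -> R) (k : 'I_N) (z := state sigma x s k) :
  state sigma x s k.+1 =
  vsub (vsub z (intermittent_policy sigma k z (s k)))
       (firm_policy sigma k z (s k)).
Proof. by rewrite /= valK. Qed.

Definition firm_supply sigma x (s : 'I_N -> R) (k : 'I_N) : N.-tuple R :=
  firm_policy sigma k (state sigma x s k) (s k).

Definition firm_price (c0 : R) : N.-tuple R := [tuple c0 | _ < N].

Definition expected_cost {d : measure_display} {T : measurableType d}
    (P : probability T R) (s : 'I_N -> {RV P >-> R}) (c0 : R)
    x sigma : \bar R :=
  (\sum_(k < N) 'E_P[fun w : T =>
     dot (firm_price c0) (firm_supply sigma x (fun i => s i w) k)])%E.

(* The first j components of the EDF allocation, in order. *)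
Fixpoint edf_prefix z (s : R) (j : nat) : seq R :=
  if j is j'.+1 then
    let m := edf_prefix z s j' in
    rcons m (Num.min z`_j' (s - \sum_(a <- m) a))
  else [::].

Definition edf_intermittent z (s : R) : N.-tuple R :=
  [tuple (edf_prefix z s N)`_j | j < N].

Definition edf_firm (k : 'I_N) z (s : R) : N.-tuple R :=
  [tuple (tnth z j - tnth (edf_intermittent z s) j) * (k == j)%:R | j < N].

Definition edf : policy := Policy (fun _ => edf_intermittent) edf_firm.

Lemma size_edf_prefix z s j : size (edf_prefix z s j) = j.
Proof. by elim: j => //= j IH; rewrite size_rcons IH. Qed.

Lemma nth_edf_prefix z s m n i : (i < m)%N -> (m <= n)%N ->
  (edf_prefix z s n)`_i = (edf_prefix z s m)`_i.
Proof.
move=> im; elim: n => [|n IH]; first by rewrite leqn0 => /eqP m0; rewrite m0 in im.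
rewrite leq_eqVlt => /predU1P[-> //|mn] /=.
by rewrite nth_rcons size_edf_prefix (leq_trans im mn) IH.
Qed.

Lemma edf_intermittentE z s (j : 'I_N) :
  tnth (edf_intermittent z s) j =
  Num.min (tnth z j)
    (s - \sum_(i < N | (i < j)%N) tnth (edf_intermittent z s) i).
Proof.
rewrite tnth_mktuple (@nth_edf_prefix z s j.+1) //=.
rewrite nth_rcons size_edf_prefix ltnn eqxx (tnth_nth 0).
congr (Num.min _ (s - _)).
rewrite (big_nth 0) size_edf_prefix big_mkord.
rewrite (big_ord_widen_cond N (fun=> true)
  (fun i => (edf_prefix z s j)`_i)) 1?ltnW//.
apply: eq_bigr => i /= ij; rewrite tnth_mktuple.
by rewrite (@nth_edf_prefix z s j) // ltnW.
Qed.

End scheduling.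

Arguments policy : clear implicits.

(* Main.v *)
(** Along every supply path, the EDF firm supply is bounded by that of any other
    feasible policy.  Write A_j for the EDF firm supply used so far plus the
    remaining EDF demand of the first j classes, and B_j for the same quantity
    under the competitor.  Then A_j <= B_j for all j >= k at every time k:
    period k replaces A_j by max (A_k, A_j - s_k) when j > k, whereas B_j drops by
    at most s_k and cannot fall below the competitor's past firm supply
    B_k >= A_k.  At k = N no demand is left, so the invariant compares the two
    total firm supplies; integrating gives the result. *)
Require Import Defs.
From HB Require Import structures.
From mathcomp Require Import all_boot all_order all_algebra.
From mathcomp Require Import all_classical all_reals all_analysis.
From mathcomp Require Import measurable_realfun lra.

Set Implicit Arguments.
Unset Strict Implicit.
Unset Printing Implicit Defensive.

Import Order.TTheory GRing.Theory Num.Theory.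
Local Open Scope classical_set_scope.
Local Open Scope ring_scope.

(** * Sums over an initial segment of the classes or of the periods *)

Definition prefix_sum {R : realType} {N : nat} (f : 'I_N -> R) (k : nat) : R :=
  \sum_(i < N | (i < k)%N) f i.

Lemma prefix_sum0 (R : realType) (N : nat) (f : 'I_N -> R) :
  prefix_sum f 0 = 0.
Proof. by rewrite /prefix_sum big_pred0. Qed.

Lemma prefix_sumS (R : realType) (N : nat) (f : 'I_N -> R) (k : 'I_N) :
  prefix_sum f k.+1 = prefix_sum f k + f k.
Proof.
rewrite /prefix_sum (bigD1 k) //= addrC; congr (_ + _).
by apply: eq_bigl => i; rewrite ltnS ltn_neqAle andbC.
Qed.

Lemma prefix_sum_full (R : realType) (N : nat) (f : 'I_N -> R) :
  prefix_sum f N = \sum_(i < N) f i.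
Proof. by apply: eq_bigl => i; rewrite ltn_ord. Qed.

Lemma prefix_sumB (R : realType) (N : nat) (f g : 'I_N -> R) (k : nat) :
  prefix_sum (fun i => f i - g i) k = prefix_sum f k - prefix_sum g k.
Proof. exact: sumrB. Qed.

Lemma prefix_sum_ge0 (R : realType) (N : nat) (f : 'I_N -> R) (k : nat) :
  (forall i, 0 <= f i) -> 0 <= prefix_sum f k.
Proof. by move=> f0; apply: sumr_ge0. Qed.

Lemma prefix_sum_le_full (R : realType) (N : nat) (f : 'I_N -> R) (k : nat) :
  (forall i, 0 <= f i) -> prefix_sum f k <= \sum_(i < N) f i.
Proof.
move=> f0; rewrite /prefix_sum big_mkcond; apply: ler_sum => i _.
by case: ifP.
Qed.

Lemma eq_prefix_sum (R : realType) (N : nat) (f g : 'I_N -> R) (k : nat) :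
  f =1 g -> prefix_sum f k = prefix_sum g k.
Proof. by move=> fg; apply: eq_bigr. Qed.

Lemma tnth_vsub (R : realType) (N : nat) (u v : N.-tuple R) (j : 'I_N) :
  tnth (vsub u v) j = tnth u j - tnth v j.
Proof. by rewrite tnth_mktuple. Qed.

(** * Feasibility and measurability of the EDF policy *)

Section edf_feasible.
Context {R : realType} {N : nat}.
Implicit Types (z : N.-tuple R) (s : R).

Lemma edf_prefix_sumS z s (j : 'I_N) (m := tnth (edf_intermittent z s)) :
  prefix_sum m j.+1 =
  prefix_sum m j + Num.min (tnth z j) (s - prefix_sum m j).
Proof. by rewrite prefix_sumS {2}/m edf_intermittentE. Qed.

(** Serving greedily in order wastes nothing: the first [j] classes receive all they ask for or else
    the whole supply. The induction step is [min a s + min b (s - min a s) = min (a + b) s] for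
    [b >= 0]; [0 <= s] is the case [j = 0]. *)
Lemma edf_prefix_sumE z s (j : nat) : nonneg z -> 0 <= s -> (j <= N)%N ->
  prefix_sum (tnth (edf_intermittent z s)) j =
  Num.min (prefix_sum (tnth z) j) s.
Proof.
move=> z0 s0; elim: j => [_|j IH jN]; first by rewrite !prefix_sum0 min_l.
rewrite (edf_prefix_sumS z s (Ordinal jN)) (prefix_sumS (tnth z) (Ordinal jN)) /=.
rewrite (IH (ltnW jN)); have := z0 (Ordinal jN).
move: (tnth z _) (prefix_sum _ _) => a b a0.
by rewrite !minEle; do !case: ifP; lra.
Qed.

Lemma edf_intermittent_le z s j : tnth (edf_intermittent z s) j <= tnth z j.
Proof. by rewrite edf_intermittentE ge_min lexx. Qed.

(** By [edf_prefix_sumE] the earlier classes take at most [s] together, so what is left for class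
    [j] is nonnegative. *)
Lemma edf_intermittent_ge0 z s : nonneg z -> 0 <= s ->
  nonneg (edf_intermittent z s).
Proof.
move=> z0 s0 j; rewrite edf_intermittentE le_min z0 subr_ge0 /=.
by rewrite -[X in X <= _]/(prefix_sum _ j) edf_prefix_sumE ?ge_min ?lexx ?orbT// ltnW.
Qed.

Lemma tnth_edf_firm (k : 'I_N) z s j : tnth (edf_firm k z s) j =
  (tnth z j - tnth (edf_intermittent z s) j) * (k == j)%:R.
Proof. by rewrite tnth_mktuple. Qed.

Lemma edf_feasible_input (k : 'I_N) z s : feasible_state k z -> 0 <= s ->
  feasible_input k z s (edf_intermittent z s, edf_firm k z s).
Proof.
move=> [z0 zk] s0; have m0 := edf_intermittent_ge0 z0 s0.
split => /=.
- exact: m0.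
- move=> j; rewrite tnth_edf_firm mulr_ge0 ?ler0n// subr_ge0.
  exact: edf_intermittent_le.
- by rewrite -prefix_sum_full edf_prefix_sumE// ge_min lexx orbT.
- split=> [j|j jk]; rewrite !tnth_vsub tnth_edf_firm.
    have := edf_intermittent_le z s j.
    by rewrite mulr_natr mulrb; case: (k == j); lra.
  (* The class of index [k] is due at the end of period [k], and firm supply clears what remains of
     it. *)
  have [|kj] := eqVneq k j; first by rewrite mulr1 subrr.
  have jk' : (j < k)%N.
    rewrite ltn_neqAle -ltnS jk andbT; apply: contraNneq kj => jk'.
    by apply/eqP/val_inj.
  (* An earlier class has no demand left, so its allocation is squeezed between 0 and 0. *)
  have := m0 j; have := edf_intermittent_le z s j; rewrite zk//.
  by rewrite mulr0; lra.
Qed.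

Lemma edf_intermittent_measurable : measurable_fun [set: N.-tuple R * R]
  (fun p => edf_intermittent p.1 p.2).
Proof.
have mz (j : 'I_N) :
    measurable_fun [set: N.-tuple R * R] (fun p => tnth p.1 j).
  exact: (measurableT_comp (measurable_tnth j) measurable_fst).
(* Each component depends on the earlier ones only through their sum, so the induction runs on
   prefix sums. *)
have msum (j : nat) : (j <= N)%N -> measurable_fun [set: N.-tuple R * R]
    (fun p => prefix_sum (tnth (edf_intermittent p.1 p.2)) j).
  elim: j => [_|j IH jN].
    by under eq_fun do rewrite prefix_sum0; exact: measurable_cst.
  under eq_fun do rewrite (edf_prefix_sumS _ _ (Ordinal jN)).
  apply: measurable_funD; first exact: IH (ltnW jN).
  apply: measurable_minr; first exact: mz.
  apply: measurable_funB; [exact: measurable_snd|exact: IH (ltnW jN)].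
apply/measurable_fun_tnthP => j.
rewrite /comp; under eq_fun do rewrite edf_intermittentE.
apply: measurable_minr; first exact: mz.
apply: measurable_funB; [exact: measurable_snd|exact: msum (ltnW _)].
Qed.

Lemma edf_firm_measurable (k : 'I_N) : measurable_fun [set: N.-tuple R * R]
  (fun p => edf_firm k p.1 p.2).
Proof.
apply/measurable_fun_tnthP => j.
rewrite /comp; under eq_fun do rewrite tnth_edf_firm.
apply: measurable_funM; last exact: measurable_cst.
apply: measurable_funB.
  exact: (measurableT_comp (measurable_tnth j) measurable_fst).
exact: (measurableT_comp (measurable_tnth j) edf_intermittent_measurable).
Qed.

Lemma edf_feasible (S : set R) (x : N.-tuple R) : S `<=` [set r | 0 <= r] ->
  feasible_policies S x edf.
Proof.
move=> S0 k; split.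
- exact: measurable_funTS edf_intermittent_measurable.
- exact: measurable_funTS (edf_firm_measurable k).
- by move=> z s zk /S0; exact: edf_feasible_input.
Qed.

End edf_feasible.

(** * Comparison of firm supplies along a fixed supply path *)

Section pathwise.
Context {R : realType} {N : nat}.
Variables (S : set R) (x : N.-tuple R) (s : 'I_N -> R).
Hypotheses (x_ge0 : nonneg x) (Ss : forall k, S (s k)).
Implicit Type sigma : policy R N.

Definition firm_total sigma (k : 'I_N) : R :=
  \sum_(j < N) tnth (firm_supply sigma x s k) j.

Lemma state_feasible sigma (k : nat) : feasible_policies S x sigma ->
  (k <= N)%N -> feasible_state k (state sigma x s k).
Proof.
move=> fsigma; elim: k => [_|k IH kN]; first by split.
have [_ _ /(_ _ _ (IH (ltnW kN)) (Ss (Ordinal kN)))[_ _ _]] := fsigma (Ordinal kN).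
by rewrite (stateS sigma x s (Ordinal kN)).
Qed.

Lemma state_prefix_sum0 sigma (k : nat) : feasible_policies S x sigma ->
  (k <= N)%N -> prefix_sum (tnth (state sigma x s k)) k = 0.
Proof.
move=> fsigma kN; have [_ z0] := state_feasible fsigma kN.
by apply: big1 => i /z0.
Qed.

Lemma policy_input_feasible sigma (k : 'I_N) (z := state sigma x s k) :
  feasible_policies S x sigma ->
  feasible_input k z (s k)
    (intermittent_policy sigma k z (s k), firm_supply sigma x s k).
Proof.
move=> fsigma; have [_ _] := fsigma k; apply; last exact: Ss.
exact: (state_feasible fsigma (ltnW (ltn_ord k))).
Qed.

Lemma firm_supply_ge0 sigma (k : 'I_N) : feasible_policies S x sigma ->
  nonneg (firm_supply sigma x s k).
Proof. by move=> /policy_input_feasible-/(_ k)[]. Qed.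

Lemma prefix_sum_stateS sigma (k : 'I_N) (j : nat) :
  prefix_sum (tnth (state sigma x s k.+1)) j =
  prefix_sum (tnth (state sigma x s k)) j -
  prefix_sum (tnth (intermittent_policy sigma k (state sigma x s k) (s k))) j -
  prefix_sum (tnth (firm_supply sigma x s k)) j.
Proof.
rewrite -!prefix_sumB stateS; apply: eq_prefix_sum => i.
by rewrite !tnth_vsub.
Qed.

(** In period [k] EDF buys firm supply only for the class of index [k], which lies in every prefix
    with [k < j]. *)
Lemma edf_firm_sum (k : 'I_N) (j : nat) (z : N.-tuple R) (r : R) : (k < j)%N ->
  prefix_sum (tnth (edf_firm k z r)) j = \sum_(i < N) tnth (edf_firm k z r) i.
Proof.
move=> kj; rewrite /prefix_sum big_mkcond; apply: eq_bigr => i _.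
rewrite tnth_edf_firm; have [<-|_] := eqVneq k i; first by rewrite kj.
by rewrite mulr0 if_same.
Qed.

(** The two sides are [A_j] and [B_j] at time [k]. The bound is stated for all [j >= k] because the
    induction step uses it both at [j] and at [k], where the remaining demand vanishes. *)
Lemma edf_dominates (S0 : S `<=` [set r | 0 <= r]) sigma (k j : nat) :
  feasible_policies S x sigma -> (k <= j)%N -> (j <= N)%N ->
  prefix_sum (firm_total edf) k + prefix_sum (tnth (state edf x s k)) j <=
  prefix_sum (firm_total sigma) k + prefix_sum (tnth (state sigma x s k)) j.
Proof.
move=> fsigma; have fedf := edf_feasible x S0.
elim: k j => [|k IH] j kj jN; first by rewrite !prefix_sum0.
have kN : (k < N)%N by exact: leq_trans jN.
pose k' := Ordinal kN.
have := IH _ (ltnW kj) jN; have := IH _ (leqnn k) (ltnW kN).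
rewrite !(state_prefix_sum0 _ (ltnW kN))//.
rewrite -[k.+1]/(k'.+1) !prefix_sumS !prefix_sum_stateS /= !addr0.
rewrite edf_prefix_sumE //; last 2 first.
- by have [] := state_feasible fedf (ltnW kN).
- exact: S0.
rewrite edf_firm_sum// -/(firm_supply edf x s k') -/(firm_total edf k').
have [u0 v0 us [z0 _]] := policy_input_feasible k' fsigma.
rewrite /= in u0 v0 us.
have := prefix_sum_le_full j u0.
have : prefix_sum (tnth (firm_supply sigma x s k')) j <= firm_total sigma k'.
  exact: prefix_sum_le_full.
have := prefix_sum_ge0 j z0.
rewrite -stateS prefix_sum_stateS /=.
have : 0 <= firm_total sigma k' by apply: sumr_ge0 => i _; exact: v0.
(* If the intermittent supply covers the first [j] classes under EDF, only past firm supply remains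
   on the left and the hypothesis at [k] suffices. Otherwise EDF spends all of [s k] on them, the
   competitor spends at most that, and the hypothesis at [j] applies. *)
by rewrite minEle; case: ifP => _; lra.
Qed.

Lemma firm_total_edf_le (S0 : S `<=` [set r | 0 <= r]) sigma :
  feasible_policies S x sigma ->
  \sum_(k < N) firm_total edf k <= \sum_(k < N) firm_total sigma k.
Proof.
move=> fsigma; have fedf := edf_feasible x S0.
have := edf_dominates S0 fsigma (leqnn N) (leqnn N).
by rewrite !state_prefix_sum0// !addr0 !prefix_sum_full.
Qed.

Lemma dot_firm_price (c : R) sigma (k : 'I_N) :
  dot (firm_price c) (firm_supply sigma x s k) = c * firm_total sigma k.
Proof.
by rewrite /dot mulr_sumr; apply: eq_bigr => j _; rewrite tnth_mktuple.
Qed.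

End pathwise.

(** * Measurability of the controlled process and passage to expectations *)

Lemma feasible_state_measurable (R : realType) (N k : nat) :
  measurable (feasible_state k : set (N.-tuple R)).
Proof.
have -> : (feasible_state k : set (N.-tuple R)) =
    \bigcap_(j in [set: 'I_N]) (@tnth N R ^~ j @^-1`
      (if (j.+1 <= k)%N then [set 0] else `[0, +oo[%classic)).
  apply/seteqP; split => z.
    move=> [z0 zk] j _ /=; case: ifPn => [/zk //|_].
    by rewrite /= in_itv/= z0.
  move=> h; split => [j|j jk]; have := h j I; rewrite /=.
    by case: ifPn => _ /=; [move=> ->|rewrite in_itv/= andbT].
  by rewrite jk.
apply: fin_bigcap_measurable => // j _.
rewrite -[X in measurable X]setTI; apply: measurable_tnth => //.
by case: ifP => _; [exact: measurable_set1|exact: measurable_itv].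
Qed.

Section expectation.
Context {R : realType} {N : nat} {d : measure_display} {T : measurableType d}.
Variables (P : probability T R) (S : set R) (s : 'I_N -> {RV P >-> R}).
Variables (x : N.-tuple R) (sigma : policy R N).
Hypotheses (mS : measurable S) (x_ge0 : nonneg x) (Ss : forall k w, S (s k w)).
Hypothesis fsigma : feasible_policies S x sigma.

Let path (w : T) (i : 'I_N) : R := s i w.

(** Policies are measurable only on [feasible_state k] times [S]; this set is measurable, and the
    pair of state and supply never leaves it. *)
Lemma control_measurable (f : N.-tuple R -> R -> N.-tuple R) (k : 'I_N) :
  measurable_fun (feasible_state k `*` S) (fun p => f p.1 p.2) ->
  measurable_fun [set: T] (fun w => state sigma x (path w) k) ->
  measurable_fun [set: T] (fun w => f (state sigma x (path w) k) (s k w)).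
Proof.
move=> mf mz; apply: (measurable_comp (g := fun w => (state sigma x (path w) k, s k w)) _ _ mf).
- by apply: measurableX => //; exact: feasible_state_measurable.
- move=> _ [w _ <-]; split => //=.
  exact: (state_feasible x_ge0 (Ss^~ w) fsigma (ltnW _)).
- by apply: measurable_fun_pair.
Qed.

Lemma state_measurable (k : nat) : (k <= N)%N ->
  measurable_fun [set: T] (fun w => state sigma x (path w) k).
Proof.
elim: k => [_|k IH kN]; first exact: measurable_cst.
pose k' := Ordinal kN; have mz := IH (ltnW kN).
have [mu mv _] := fsigma k'.
have mu' := control_measurable mu mz.
have mv' := control_measurable mv mz.
under eq_fun do rewrite (stateS _ _ _ k').
apply/measurable_fun_tnthP => j.
rewrite /comp; under eq_fun do rewrite !tnth_vsub.
apply: measurable_funB; last exact: (measurableT_comp (measurable_tnth j) mv').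
apply: measurable_funB; first exact: (measurableT_comp (measurable_tnth j) mz).
exact: (measurableT_comp (measurable_tnth j) mu').
Qed.

Lemma firm_total_measurable (k : 'I_N) :
  measurable_fun [set: T] (fun w => firm_total x (path w) sigma k).
Proof.
have [_ mv _] := fsigma k.
have mv' := control_measurable mv (state_measurable (ltnW (ltn_ord k))).
by apply: measurable_sum => j; exact: (measurableT_comp (measurable_tnth j) mv').
Qed.

(** Firm costs are nonnegative, so the sum over periods and the integral commute with no
    integrability to check. *)
Lemma expected_costE (c : R) : 0 <= c ->
  (expected_cost s c x sigma =
   \int[P]_w (c * \sum_(k < N) firm_total x (path w) sigma k)%:E)%E.
Proof.
move=> c0; rewrite /expected_cost expectation.unlock.
under eq_bigr do under eq_integral do rewrite dot_firm_price.
rewrite -ge0_integral_sum //.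
- by apply: eq_integral => w _; rewrite sumEFin mulr_sumr.
- move=> k; apply/measurable_EFinP; apply: measurable_funM => //.
  exact: firm_total_measurable.
- move=> k w _; rewrite lee_fin mulr_ge0// sumr_ge0// => j _.
  exact: (firm_supply_ge0 x_ge0 (Ss^~ w)).
Qed.

End expectation.

Theorem theorem1 (R : realType) (N : nat) (hN : (1 <= N)%N)
  (c0 : R) (hc0 : 0 < c0)
  (S : set R) (hS : is_interval S) (hS0 : S `<=` [set r | 0 <= r])
  (d : measure_display) (Omega : measurableType d) (P : probability Omega R)
  (s : 'I_N -> {RV P >-> R}) (hs : forall k w, S (s k w))
  (x : N.-tuple R) (hx : nonneg x) :
  feasible_policies S x edf /\
  (forall sigma : policy R N, feasible_policies S x sigma ->
     (expected_cost s c0 x edf <= expected_cost s c0 x sigma)%E).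
Proof.
have fedf := edf_feasible x hS0; split => // sigma fsigma.
(* An interval is a Borel set, as the measurability of the costs requires. *)
have mS := is_interval_measurable hS.
have mcost tau (ftau : feasible_policies S x tau) : measurable_fun setT
    (fun w => (c0 * \sum_(k < N) firm_total x (fun i => s i w) tau k)%:E).
  apply/measurable_EFinP; apply: measurable_funM => //.
  by apply: measurable_sum => k; exact: (firm_total_measurable mS).
have c0_ge0 := ltW hc0.
(* Both costs are now integrals of nonnegative functions, so the pathwise bound is enough. *)
rewrite !(expected_costE mS)//; apply: ge0_le_integral => //.
- move=> w _; rewrite lee_fin mulr_ge0// sumr_ge0// => k _.
  rewrite sumr_ge0// => j _.
  exact: (firm_supply_ge0 hx (hs^~ w)).
- exact: mcost.
- exact: mcost.
- move=> w _; rewrite lee_fin ler_pM2l//.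
  exact: (firm_total_edf_le hx (hs^~ w)).
Qed.
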